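(* Let $G$ be a finite group and suppose $G=G_1G_2\cdots G_n$, where $G_1,\dots,G_n$ are pairwise totally permutable subgroups of $G$. Let $\Gamma(G)$ denote the graph with vertex set $\pi(G)$ and edge set $\{(p,q)\mid p,q\in\pi(G),\ q\in\pi(p-1)\}$. Then $$\Gamma_s(G)\subseteq\bigcup_{i=1}^n\Gamma_s(G_i)\cup\Gamma(G),\quad \Gamma_H(G)\subseteq\bigcup_{i=1}^n\Gamma_H(G_i)\cup\Gamma(G),\quad \Gamma_{Nc}(G)\subseteq\bigcup_{i=1}^n\Gamma_{Nc}(G_i)\cup\Gamma(G).$$
   Context: All groups are finite; $\pi(G)$ denotes the set of prime divisors of $|G|$, and $\pi(n)$ the set of prime divisors of an integer $n$. Graphs are directed: a graph $\Gamma$ consists of a vertex set $V(\Gamma)$ and an edge set $E(\Gamma)$ of ordered pairs of vertices. The union of graphs takes the union of vertex sets and of edge sets; $\Gamma_1\subseteq\Gamma_2$ means $V(\Gamma_1)\subseteq V(\Gamma_2)$ and $E(\Gamma_1)\subseteq E(\Gamma_2)$. $O_{p',p}(G)$ is the largest normal $p$-nilpotent subgroup of $G$. The Hawkes graph $\Gamma_H(G)$ has vertex set $\pi(G)$ and an edge $(p,q)$ whenever $q\in\pi(G/O_{p',p}(G))$. The Sylow graph $\Gamma_s(G)$ has vertex set $\pi(G)$ and an edge $(p,q)$ whenever $q\in\pi(N_G(P)/PC_G(P))$ for some Sylow $p$-subgroup $P$ of $G$. A Schmidt group is a non-nilpotent group all of whose proper subgroups are nilpotent; a Schmidt $(p,q)$-group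 is a Schmidt group $S$ with $\pi(S)=\{p,q\}$ and a normal Sylow $p$-subgroup. The $N$-critical graph $\Gamma_{Nc}(G)$ has vertex set $\pi(G)$ and an edge $(p,q)$ whenever $G$ contains a Schmidt $(p,q)$-subgroup. Subgroups $H$ and $K$ are totally permutable if every subgroup of $H$ permutes with every subgroup of $K$; ''pairwise totally permutable'' means $G_i$ and $G_j$ are totally permutable for all $i\neq j$. *)

(* Defs.v *)
From mathcomp Require Import all_boot all_fingroup all_solvable.
Set Implicit Arguments. Unset Strict Implicit. Unset Printing Implicit Defensive.
Import GroupScope.

Record graph := Graph { gV : nat -> Prop ; gE : nat -> nat -> Prop }.

Definition gsub (A B : graph) : Prop :=
  (forall p, gV A p -> gV B p) /\ (forall p q, gE A p q -> gE B p q).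

Definition gunion (A B : graph) : graph :=
  Graph (fun p => gV A p \/ gV B p) (fun p q => gE A p q \/ gE B p q).

Definition gbigunion (n : nat) (F : 'I_n -> graph) : graph :=
  Graph (fun p => exists i, gV (F i) p) (fun p q => exists i, gE (F i) p q).

Definition hawkes_graph (gT : finGroupType) (G : {group gT}) : graph :=
  Graph (fun p => p \in \pi(G))
        (fun p q => [/\ p \in \pi(G), q \in \pi(G) &
                        q \in \pi(G / 'O_{p^', p}(G))]).

Definition sylow_graph (gT : finGroupType) (G : {group gT}) : graph :=
  Graph (fun p => p \in \pi(G))
        (fun p q => [/\ p \in \pi(G), q \in \pi(G) &
           exists P : {group gT}, P \in 'Syl_p(G) /\
             q \in \pi(#|'N_G(P) : P * 'C_G(P)|)]).

Definition schmidt (gT : finGroupType) (S : {group gT}) : Prop :=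
  ~~ nilpotent S /\ (forall H : {group gT}, H \proper S -> nilpotent H).

Definition schmidt_pq (gT : finGroupType) (p q : nat) (S : {group gT}) : Prop :=
  [/\ schmidt S,
      (forall r, r \in \pi(S) <-> (r = p \/ r = q)) &
      exists P : {group gT}, P \in 'Syl_p(S) /\ P <| S].

Definition ncritical_graph (gT : finGroupType) (G : {group gT}) : graph :=
  Graph (fun p => p \in \pi(G))
        (fun p q => [/\ p \in \pi(G), q \in \pi(G) &
           exists S : {group gT}, S \subset G /\ schmidt_pq p q S]).

Definition gamma_graph (gT : finGroupType) (G : {group gT}) : graph :=
  Graph (fun p => p \in \pi(G))
        (fun p q => [/\ p \in \pi(G), q \in \pi(G) & q \in \pi(p.-1)]).

Definition totally_permutable (gT : finGroupType) (H K : {group gT}) : Prop :=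
  forall X Y : {group gT}, X \subset H -> Y \subset K -> X * Y = Y * X.

(* Main.v *)
(* Fix primes [p], [q] with [q] not dividing [p - 1].  For each of the three graphs, the
   groups without the edge [(p, q)] form a class closed under the operations listed in
   [edge_free_class], and every such class is closed under totally permutable products:

   Let [r] be the largest prime divisor of [|G|].  A cyclic [r]-group is normal in its
   product with a permuting cyclic [s]-group, for a prime [s < r], so the [r']-elements of
   one factor act as power automorphisms on the [r]-subgroups of the others.  This forces
   either some factor [G_i] to contain a nontrivial normal subgroup centralized by all
   other factors, or the Sylow [r]-subgroup [T] of [G] to be normal.  In the first case
   induct modulo that subgroup, on which [G] acts as [G_i] does.  In the second case
   induct modulo [T] if [r <> p]; if [r = p], then [q < p] and [q]-elements of a factor
   centralize the [p]-elements of the other ones, hence [q]-elements of [G] centralize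
   [T]. *)
Require Import Defs.
From mathcomp Require Import all_boot all_fingroup all_solvable.
Set Implicit Arguments. Unset Strict Implicit. Unset Printing Implicit Defensive.
Import GroupScope.

(** * Products of two cyclic groups *)

Section CyclicProducts.

Implicit Types gT : finGroupType.

(** If [X] met [X :^ g] trivially, their product would have [#|X| ^ 2] elements inside [M]. So they
    share a subgroup of order [r], unique in each of these cyclic groups. *)
Lemma cyclic_pgroup_normal_prime gT r (M X : {group gT}) :
    prime r -> cyclic X -> r.-group X -> X \subset M -> #|M| < #|X| ^ 2 ->
  exists Z : {group gT}, [/\ Z \subset X, #|Z| = r & Z <| M].
Proof.
move=> pr_r cycX rX sXM ltMX.
have ntX: X :!=: 1.
  apply: contraL ltMX => /eqP->.
  by rewrite cards1 exp1n -leqNgt cardG_gt0.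
have [_ r_dv_X _] := pgroup_pdiv rX ntX.
have [z Xz oz] := Cauchy pr_r r_dv_X.
exists <[z]>%G; split; rewrite ?cycle_subG //= /normal cycle_subG (subsetP sXM) //=.
apply/subsetP=> g Mg; rewrite inE -cycleJ.
have ntI: X :&: X :^ g != 1.
  apply: contraL ltMX => /eqP tiXXg; rewrite -leqNgt.
  rewrite expnS expn1 -{2}(cardJg X g) -TI_cardMg //.
  by rewrite subset_leq_card // mul_subG // -(conjGid Mg) conjSg.
have rI: r.-group (X :&: X :^ g) by apply: pgroupS rX; rewrite subsetIl.
have [_ r_dv_I _] := pgroup_pdiv rI ntI.
have [w /setIP[Xw Xgw] ow] := Cauchy pr_r r_dv_I.
have ->: <[z ^ g]> = <[w]>.
  apply/eqP; rewrite (eq_subG_cyclic (G := (X :^ g)%G)) ?cyclicJ ?cycle_subG ?memJ_conjg //.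
  by rewrite -!orderE orderJ oz ow.
suffices ->: <[w]> = <[z]> by [].
by apply/eqP; rewrite (eq_subG_cyclic cycX) ?cycle_subG // -!orderE oz ow.
Qed.

(** The number of fixed points of [X] on [Z] is congruent to [s] modulo [p]; were it 1, [p] would
    divide [s.-1]. *)
Lemma pgroup_cent_prime gT (p s : nat) (X Z : {group gT}) :
    prime s -> #|Z| = s -> p.-group X -> ~~ (p %| s.-1) -> X \subset 'N(Z) ->
  X \subset 'C(Z).
Proof.
move=> pr_s oZ pX p'Z nZX; rewrite centsC.
have prZ : prime #|Z| by rewrite oZ.
have [//| tiZC] := prime_subgroupVti ('C(X))%G prZ.
have actZ : [acts X, on Z | 'J] by rewrite astabsJ.
have := pgroup_fix_mod pX actZ; rewrite afixJ setIC tiZC cards1 oZ => /eqP.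
by rewrite eqn_mod_dvd ?prime_gt0 // subn1 (negPf p'Z).
Qed.

(* Induction on the order of the product: the larger factor meets all its
   conjugates, so its subgroup of prime order is normal and can be factored out. *)
Lemma cyclic_pgroups_norm gT r s (X Y : {group gT}) :
    prime r -> prime s -> s < r -> r.-group X -> s.-group Y ->
    cyclic X -> cyclic Y -> X * Y = Y * X ->
  Y \subset 'N(X).
Proof.
move=> pr_r pr_s lt_sr; have [m] := ubnP (#|X| * #|Y|).
elim: m => // m IHm in gT X Y *; rewrite ltnS => leXYm rX sY cycX cycY cXY.
have coXY: coprime #|X| #|Y|.
  by apply: (pnat_coprime rX); apply: sub_pgroup sY => t /eqnP->; rewrite !inE /= neq_ltn lt_sr.
have gM : X <*> Y = X * Y by rewrite comm_joingE.
have oM: #|X <*> Y| = (#|X| * #|Y|)%N by rewrite gM coprime_cardMg.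
have [sXM sYM] := (joing_subl X Y, joing_subr X Y).
have quoIH (Z : {group gT}) : Z <| X <*> Y -> Z :!=: 1 -> Y / Z \subset 'N(X / Z).
  move=> nsZM ntZ; have nZM := normal_norm nsZM.
  have nZX := subset_trans sXM nZM; have nZY := subset_trans sYM nZM.
  apply: IHm; rewrite ?quotient_pgroup ?quotient_cyclic //; last first.
    by rewrite -!quotientMl ?cXY.
  rewrite -coprime_cardMg ?coprime_morph // -quotientMl // -gM.
  by apply: leq_trans leXYm; rewrite -oM ltn_quotient // normal_sub.
have [ltYX | ltXY | eqXY] := ltngtP #|Y| #|X|.
- have [|Z [sZX oZ nsZM]] := cyclic_pgroup_normal_prime pr_r cycX rX sXM.
    by rewrite oM expnS expn1 ltn_pmul2l ?cardG_gt0.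
  have ntZ : Z :!=: 1 by rewrite -cardG_gt1 oZ prime_gt1.
  have nZM := normal_norm nsZM.
  have nsZX := normalS sZX sXM nsZM.
  by rewrite -(@quotientSGK _ Z _ 'N(X)%G) ?(subset_trans sYM) ?(subset_trans sZX) ?normG //
             quotient_normG // quoIH.
- have [|Z [sZY oZ nsZM]] := cyclic_pgroup_normal_prime pr_s cycY sY sYM.
    by rewrite oM expnS expn1 ltn_pmul2r ?cardG_gt0.
  have nZM := normal_norm nsZM.
  have cXZ : X \subset 'C(Z).
    apply: (pgroup_cent_prime pr_s oZ rX); last exact: subset_trans nZM.
    by rewrite gtnNdvd ?(leq_ltn_trans (leq_pred s)) // -subn1 subn_gt0 prime_gt1.
  have nXZY : Y \subset 'N(X <*> Z).
    have nZY := subset_trans sYM nZM.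
    have nsZXZ : Z <| X <*> Z by rewrite /normal joing_subr join_subG normG (subset_trans sXM).
    rewrite -(@quotientSGK _ Z _ 'N(X <*> Z)%G nZY) /=; last by rewrite normsG ?joing_subr.
    by rewrite quotient_normG // quotientYidr ?quoIH ?(subset_trans sXM) // -cardG_gt1 oZ prime_gt1.
  (* [X] commutes with [Z], so it is the normal Sylow [r]-subgroup of [X <*> Z], hence
     characteristic there. *)
  suffices <- : 'O_r(X <*> Z) = X by rewrite (char_norm_trans (pcore_char _ _)).
  apply: normal_Hall_pcore.
    rewrite /pHall joing_subl rX -divgS ?joing_subl //= cent_joinEr 1?centsC //.
    rewrite coprime_cardMg ?(coprimegS sZY) // mulKn ?cardG_gt0 //.
    by apply: sub_pgroup (pgroupS sZY sY) => t /eqnP->; rewrite !inE /= neq_ltn lt_sr.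
  by rewrite /normal joing_subl join_subG normG cents_norm // centsC.
- have := coXY; rewrite eqXY /coprime gcdnn -trivg_card1 => /eqP X1.
  by rewrite X1 norm1 subsetT.
Qed.

End CyclicProducts.

(** * Subgroups generated by [pi]-elements, and power automorphisms *)

Section GeneratedByElements.

Implicit Types (gT : finGroupType) (pi : nat_pred).

(** This is [O^{pi'}(G)], the smallest normal subgroup with a [pi']-quotient, given by generators
    because permutability will be applied to cyclic subgroups. *)
Definition elt_gen gT pi (G : {group gT}) : {group gT} :=
  <<[set x in G | pi.-elt x]>>%G.

Lemma elt_gen_sub gT pi (G : {group gT}) : elt_gen pi G \subset G.
Proof. by rewrite gen_subG; apply/subsetP=> x; rewrite inE => /andP[]. Qed.

Lemma mem_elt_gen gT pi (G : {group gT}) x : x \in G -> pi.-elt x -> x \in elt_gen pi G.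
Proof. by move=> Gx pi_x; rewrite mem_gen // inE Gx. Qed.

Lemma elt_gen_subP gT pi (G H : {group gT}) :
  reflect (forall x, x \in G -> pi.-elt x -> x \in H) (elt_gen pi G \subset H).
Proof.
rewrite gen_subG; apply: (iffP subsetP) => [sGH x Gx pi_x | sGH x].
  by apply: sGH; rewrite inE Gx.
by rewrite inE => /andP[]; apply: sGH.
Qed.

Lemma elt_gen_norm gT pi (G : {group gT}) : 'N(G) \subset 'N(elt_gen pi G).
Proof.
apply/norms_gen/subsetP=> y nGy; rewrite inE.
apply/subsetP=> z; rewrite mem_conjg !inE => /andP[].
by rewrite p_eltJ memJ_norm ?groupV // => -> ->.
Qed.

Lemma elt_gen_norm_cycles gT pi (G : {group gT}) y :
    (forall x, x \in G -> pi.-elt x -> y \in 'N(<[x]>)) -> y \in 'N(elt_gen pi G).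
Proof.
move=> nGy; rewrite -cycle_subG norms_gen // cycle_subG inE.
apply/subsetP=> _ /imsetP[x Sx ->].
have /andP[Gx pi_x] : (x \in G) && pi.-elt x by move: Sx; rewrite inE.
rewrite inE p_eltJ pi_x andbT.
have : x ^ y \in <[x]> by rewrite memJ_norm ?cycle_id ?nGy.
by apply: subsetP; rewrite cycle_subG.
Qed.

Lemma elt_gen_normal gT pi (G : {group gT}) : elt_gen pi G <| G.
Proof. by rewrite /normal elt_gen_sub (subset_trans (normG G)) ?elt_gen_norm. Qed.

Lemma quotient_p_eltP gT pi (K G : {group gT}) xK :
    G \subset 'N(K) -> xK \in G / K -> pi.-elt xK ->
  exists x, [/\ x \in G, pi.-elt x & xK = coset K x].
Proof.
move=> nKG /morphimP[x nKx Gx ->] pi_x; exists x.`_pi.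
by rewrite groupX ?p_elt_constt // morph_constt // constt_p_elt.
Qed.

Lemma elt_gen_quotient gT pi (K G : {group gT}) :
  G \subset 'N(K) -> elt_gen pi (G / K) = (elt_gen pi G / K)%G.
Proof.
move=> nKG; apply/val_inj/eqP; rewrite eqEsubset /=; apply/andP; split.
  apply/elt_gen_subP=> xK GKx /(quotient_p_eltP nKG GKx)[x [Gx pi_x ->]].
  by rewrite mem_quotient ?mem_elt_gen.
rewrite quotient_gen; last first.
  by apply/subsetP=> x; rewrite inE => /andP[/(subsetP nKG)].
apply: genS; apply/subsetP=> _ /morphimP[x nKx + ->].
by rewrite !inE => /andP[Gx pi_x]; rewrite mem_quotient ?morph_p_elt.
Qed.

(** A prime of [pi] dividing the order of [G / K] gives, by Cauchy, a nontrivial [pi]-element of the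
    quotient, which lifts to a [pi]-element outside [K]. *)
Lemma pi'_quotientP gT pi (K G : {group gT}) : G \subset 'N(K) ->
  reflect (forall x, x \in G -> pi.-elt x -> x \in K) (pi^'.-group (G / K)).
Proof.
move=> nKG; apply: (iffP idP) => [pi'GK x Gx pi_x | sGK].
  rewrite coset_idr ?(subsetP nKG) //; apply/eqP.
  have nKx := subsetP nKG x Gx; have xK := mem_quotient K Gx.
  rewrite -order_eq1; apply/eqP/(@pnat_1 pi); first exact: morph_p_elt.
  exact: mem_p_elt pi'GK xK.
apply/pgroupP=> s pr_s /(Cauchy pr_s)[xK GKx ox]; apply/negP=> pi_s.
have s_x: s.-elt xK by rewrite /p_elt ox pnat_id.
have [x [Gx sx def_x]] := quotient_p_eltP nKG GKx s_x.
have Kx: x \in K by apply: sGK => //; apply: sub_p_elt sx => t /eqnP->.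
by move: (prime_gt1 pr_s); rewrite -ox def_x coset_id // order1.
Qed.

Lemma mem_constt_primes gT (G : {group gT}) x :
  (forall p, p \in \pi(#[x]) -> x.`_p \in G) -> x \in G.
Proof.
move=> Gx; rewrite -(prod_constt x); apply: group_prod => p _.
have [/Gx // | p'x] := boolP (p \in \pi(#[x])).
suffices ->: x.`_p = 1 by [].
apply/constt1P; rewrite /p_elt /pnat order_gt0 /=.
by apply/allP=> s x_s; rewrite !inE; apply: contraNneq p'x => <-.
Qed.

End GeneratedByElements.

Section PowerAction.

Variables (gT : finGroupType) (r : nat).
Implicit Types (R : {group gT}) (b d : gT).

(** By coprime action, [[~: <[d]>, <[b]>]] meets the centralizer of [b] trivially. Were
    ['C_<[d]>[b]] nontrivial too, both would contain the only subgroup of order [r] of [<[d]>]. *)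
Lemma cyclic_cent1_TI b d :
    prime r -> r.-elt d -> r^'.-elt b -> b \in 'N(<[d]>) -> [~ d, b] != 1 ->
  'C_<[d]>[b] = 1.
Proof.
move=> pr_r rd r'b nDb ntdb; apply/eqP/contraT=> ntC.
have nDB: <[b]> \subset 'N(<[d]>) by rewrite cycle_subG.
have TI := coprime_abel_cent_TI nDB (pnat_coprime rd r'b) (cycle_abelian d).
have sub_r (H : {group gT}) : H \subset <[d]> -> H :!=: 1 -> exists2 z, z \in H & #[z] = r.
  move=> sHD ntH; have rH := pgroupS sHD rd.
  have [_ r_dv_H _] := pgroup_pdiv rH ntH.
  by have [z] := Cauchy pr_r r_dv_H; exists z.
have [|z /setIP[Dz cbz] oz] := sub_r [group of 'C_<[d]>[b]] _ ntC; first exact: subsetIl.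
have sRD: [~: <[d]>, <[b]>] \subset <[d]> by rewrite commg_subl.
have [|w Rw ow] := sub_r [group of [~: <[d]>, <[b]>]] sRD.
  apply: contraNneq ntdb => R1.
  by rewrite -in_set1 -[[set 1]]R1 mem_commg ?cycle_id.
have Dw := subsetP sRD w Rw.
have eqzw: <[z]> = <[w]>.
  by apply/eqP; rewrite (eq_subG_cyclic (cycle_cyclic d)) ?cycle_subG // -!orderE oz ow.
have: z \in 'C_[~: <[d]>, <[b]>](<[b]>).
  by rewrite inE cent_cycle cbz andbT -cycle_subG eqzw cycle_subG.
by rewrite TI => /set1P z1; move: (prime_gt1 pr_r); rewrite -oz z1 order1.
Qed.

(** With [m] the order of [[~ d, b]], the power [d ^+ m] commutes with [b], so it is trivial and
    [#[d]] divides [m]. *)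
Lemma cyclic_commg_generator b d :
    prime r -> r.-elt d -> r^'.-elt b -> b \in 'N(<[d]>) -> [~ d, b] != 1 ->
  d \in <[[~ d, b]]>.
Proof.
move=> pr_r rd r'b nDb ntdb.
have TI := cyclic_cent1_TI pr_r rd r'b nDb ntdb.
have Dc: [~ d, b] \in <[d]> by rewrite commgEl groupM ?groupV ?memJ_norm ?cycle_id.
suffices /eqP->: <[[~ d, b]]> == <[d]> by rewrite cycle_id.
rewrite eqEcard cycle_subG Dc -!orderE dvdn_leq // order_dvdn -in_set1 -[[set 1]]TI inE mem_cycle.
apply/cent1P/commgP; rewrite commXg ?expg_order //.
exact: (centsP (cycle_abelian d)) _ (cycle_id d) _ Dc.
Qed.

(* If [c] is fixed by [b] and [d] is not, then [[c * d, b] = [d, b]] generates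
   [<[d]>], so [c] lies in [<[c * d]>], on which [b] has no fixed points. *)
Lemma power_action_cent R b :
    prime r -> r.-group R -> r^'.-elt b -> (forall d, d \in R -> b \in 'N(<[d]>)) ->
  'C_R[b] != 1 -> b \in 'C(R).
Proof.
move=> pr_r rR r'b nRb /trivgPn[c /setIP[Rc /cent1P cbc] ntc].
apply/centP=> d Rd; apply/commgP; rewrite -invg_comm invg_eq1.
apply: contraR ntc => ntdb.
have Rcd: c * d \in R by rewrite groupM.
have ecd: [~ c * d, b] = [~ d, b].
  by rewrite commMgJ (eqP (introT commgP cbc)) conj1g mul1g.
have ntcd: [~ c * d, b] != 1 by rewrite ecd.
have TI := cyclic_cent1_TI pr_r (mem_p_elt rR Rcd) r'b (nRb _ Rcd) ntcd.
rewrite -in_set1 -[[set 1]]TI inE (introT cent1P cbc) andbT.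
have cdd: d \in <[c * d]>.
  have := cyclic_commg_generator pr_r (mem_p_elt rR Rd) r'b (nRb _ Rd) ntdb.
  apply: subsetP; rewrite cycle_subG -ecd commgEl groupM ?groupV ?memJ_norm ?cycle_id ?nRb //.
by rewrite -(groupMr _ cdd) cycle_id.
Qed.

(** Without nontrivial fixed points, [x |-> [~ x, b]] is an injective self-map of [R], hence
    onto. *)
Lemma commg_sub_cent1_TI (R S : {group gT}) b :
    b \in 'N(R) -> 'C_R[b] = 1 -> (forall x, x \in R -> [~ x, b] \in S) ->
  R \subset S.
Proof.
move=> nRb TI sRS.
have injR: {in R &, injective (fun x => [~ x, b])}.
  move=> x y Rx Ry /= exy; apply/eqP; rewrite eq_mulgV1 -in_set1 -[[set 1]]TI inE.
  rewrite groupM ?groupV //=; apply/cent1P/commgP/conjg_fixP.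
  rewrite conjMg conjVg -(mulKVg x (x ^ b)) -(mulKVg y (y ^ b)) -!commgEl exy.
  by rewrite invMg mulgA mulgK.
have sRR: [set [~ x, b] | x in R] \subset R.
  by apply/subsetP=> _ /imsetP[x Rx ->]; rewrite commgEl groupM ?groupV ?memJ_norm.
have /eqP eqR: [set [~ x, b] | x in R] == R by rewrite eqEcard sRR (card_in_imset injR) leqnn.
by rewrite -eqR; apply/subsetP=> _ /imsetP[x Rx ->]; apply: sRS.
Qed.

Lemma der1_cent_cyclic (K C : {group gT}) :
  cyclic C -> K \subset 'N(C) -> K^`(1) \subset 'C(C).
Proof.
move=> cycC nCK; rewrite -ker_conj_aut ker_trivg_morphim (subset_trans (der_sub 1 K)) //=.
rewrite morphim_der // (derG1P _) //.
exact: abelianS (Aut_conj_aut C _) (Aut_cyclic_abelian cycC).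
Qed.

(** [U] has index 1 or [r] in the [r]-group [U * <[v]>], hence is normal in it. *)
Lemma order_p_norm_pgroup (U : {group gT}) v :
  r.-group U -> prime r -> #[v] = r -> U * <[v]> = <[v]> * U -> v \in 'N(U).
Proof.
move=> rU pr_r ov cUV.
have prV: prime #|<[v]>| by rewrite -orderE ov.
have [sVU | tiUV] := prime_subgroupVti U prV.
  by rewrite (subsetP (normG U)) // -cycle_subG.
have gM : U <*> <[v]> = U * <[v]> by rewrite comm_joingE.
have rM: r.-group (U <*> <[v]>).
  by rewrite gM pgroupM rU /pgroup -orderE ov pnat_id.
have: maximal U (U <*> <[v]>).
  apply: p_index_maximal; rewrite ?joing_subl // -divgS ?joing_subl //= gM.
  by rewrite TI_cardMg // mulKn.
move/(p_maximal_normal rM)/normal_norm/subsetP; apply.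
by rewrite (subsetP (joing_subr _ _)) ?cycle_id.
Qed.

End PowerAction.

(** * Totally permutable products *)

Section TotallyPermutablePair.

Variables (gT : finGroupType) (r : nat).
Hypothesis pr_r : prime r.
Implicit Types (A B R S T : {group gT}) (x y b v : gT).

Lemma totally_permutable_sym A B : totally_permutable A B -> totally_permutable B A.
Proof. by move=> tAB X Y sXB sYA; apply/esym/tAB. Qed.

(** The cyclic case applies to each primary part of [y]: its prime is at most [r] since it divides
    [#|B|], and is not [r] since [y] is an [r']-element. *)
Lemma tp_norm_cycle A B x y :
    totally_permutable A B -> {in \pi(B), forall s, s <= r} ->
    x \in A -> r.-elt x -> y \in B -> r^'.-elt y ->
  y \in 'N(<[x]>).
Proof.
move=> tAB maxr Ax rx By r'y; apply: (@mem_constt_primes _ 'N(<[x]>)%G) => p y_p.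
have [pr_p _ p_dv_y] : [/\ prime p, 0 < #[y] & p %| #[y]].
  by move: y_p; rewrite mem_primes => /and3P.
have Bp : p \in \pi(B) by rewrite mem_primes pr_p cardG_gt0 (dvdn_trans p_dv_y) ?order_dvdG.
have ltpr : p < r.
  rewrite ltn_neqAle maxr // andbT.
  by have := pnatP _ (order_gt0 y) r'y p pr_p p_dv_y; rewrite !inE.
rewrite -cycle_subG.
apply: (cyclic_pgroups_norm pr_r pr_p ltpr) => //; rewrite ?cycle_cyclic ?/(pgroup _ _) //.
  exact: p_elt_constt.
by apply: tAB; rewrite cycle_subG ?groupX.
Qed.

Lemma norm_cycles_norm (H : {group gT}) b :
  (forall x, x \in H -> b \in 'N(<[x]>)) -> b \in 'N(H).
Proof.
move=> nHb; rewrite inE; apply/subsetP=> _ /imsetP[x Hx ->].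
have: x ^ b \in <[x]> by rewrite memJ_norm ?cycle_id ?nHb.
by apply: subsetP; rewrite cycle_subG.
Qed.

(* If [b] fixes no nontrivial element of a Sylow subgroup [R], then [R] consists of
   commutators [[t, b]] with [t] in [R].  As [b] and its conjugate by [t] normalize
   every Sylow subgroup, so does [[t, b]], hence [R] is contained in all of them. *)
Lemma tp_cent_elt_gen A B b :
    totally_permutable A B -> {in \pi(B), forall s, s <= r} ->
    b \in B -> r^'.-elt b -> ~~ r.-group (elt_gen r A) ->
  b \in 'C(elt_gen r A).
Proof.
move=> tAB maxr Bb r'b; apply: contraR => not_cb.
have nb x : x \in A -> r.-elt x -> b \in 'N(<[x]>).
  by move=> Ax rx; apply: tp_norm_cycle tAB maxr Ax rx Bb r'b.
have nRb R : r.-Sylow(A) R -> forall x, x \in R -> b \in 'N(<[x]>).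
  move=> sylR x Rx; have rR := pHall_pgroup sylR.
  by apply: nb; rewrite ?(subsetP (pHall_sub sylR)) // (mem_p_elt rR).
have: ~~ (elt_gen r A \subset 'C[b]).
  by apply: contra not_cb; rewrite -sub_cent1.
rewrite gen_subG => /subsetPn[x]; rewrite inE => /andP[Ax rx] ncx.
have sxA : <[x]> \subset A by rewrite cycle_subG.
have [R sylR sxR] := Sylow_superset sxA rx.
have rR := pHall_pgroup sylR.
have TI : 'C_R[b] = 1.
  apply/eqP/contraT=> /(power_action_cent pr_r rR r'b (nRb _ sylR)).
  rewrite -sub_cent1 => /subsetP/(_ x); rewrite -cycle_subG sxR => /(_ isT).
  by rewrite (negPf ncx).
have sR S : r.-Sylow(A) S -> R \subset S.
  move=> sylS; apply: (commg_sub_cent1_TI (norm_cycles_norm (nRb _ sylR)) TI) => t Rt.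
  have At : t \in A by apply: subsetP Rt; apply: pHall_sub sylR.
  have nbS t' : t' \in A -> b ^ t' \in 'N(S).
    move=> At'; rewrite -mem_conjgV -normJ; apply: norm_cycles_norm => z Sz.
    by apply: nRb Sz; rewrite pHallJ ?groupV.
  have Rtb : [~ t, b] \in R.
    by rewrite commgEl groupM ?groupV // memJ_norm // norm_cycles_norm // => z; apply: nRb.
  rewrite -cycle_subG; apply: (norm_sub_max_pgroup (Hall_max sylS)).
  - exact: mem_p_elt rR Rtb.
  - by rewrite cycle_subG (subsetP (pHall_sub sylR)).
  have nSb : b \in 'N(S) by rewrite -[b]conjg1 nbS.
  by rewrite cycle_subG commgEr conjVg groupM // groupV nbS.
apply: pgroupS rR; apply/elt_gen_subP=> z Az rz.
have szA : <[z]> \subset A by rewrite cycle_subG.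
have [S sylS szS] := Sylow_superset szA rz.
suffices /eqP->: R :==: S by rewrite -cycle_subG.
by rewrite eqEcard sR // (card_Hall sylS) (card_Hall sylR) leqnn.
Qed.

(** This is [O^r(O^{r'}(A))], the source of normal subgroups of [A] centralized by the other
    factors. *)
Let elt_gen2 A := elt_gen r^' (elt_gen r A).

Lemma tp_elt_gen2_norm_cycle A B v :
    totally_permutable A B -> {in \pi(A), forall s, s <= r} -> v \in B -> r.-elt v ->
  elt_gen2 A \subset 'N(<[v]>).
Proof.
move=> tAB maxA Bv rv; apply/elt_gen_subP=> x Tx r'x.
have Ax := subsetP (elt_gen_sub r A) x Tx.
exact: tp_norm_cycle (totally_permutable_sym tAB) maxA Bv rv Ax r'x.
Qed.

(** Split an element of [B] into its [r]-part and [r']-part. [elt_gen2 A] acts on the cyclic group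
    of the former through an abelian automorphism group; the latter centralizes all of
    [elt_gen r A]. *)
Lemma tp_der_elt_gen2_cent A B :
    totally_permutable A B -> {in \pi(A), forall s, s <= r} -> {in \pi(B), forall s, s <= r} ->
    ~~ r.-group (elt_gen r A) ->
  (elt_gen2 A)^`(1) \subset 'C(B).
Proof.
move=> tAB maxA maxB r'T; rewrite centsC; apply/subsetP=> b Bb.
rewrite -(consttC r b) groupM //=.
  have nK := tp_elt_gen2_norm_cycle tAB maxA (groupX _ Bb) (p_elt_constt r b).
  by rewrite -cycle_subG centsC der1_cent_cyclic ?cycle_cyclic.
have cbT := tp_cent_elt_gen tAB maxB (groupX _ Bb) (p_elt_constt r^' b) r'T.
by apply: subsetP cbT; rewrite centS // (subset_trans (der_sub 1 _)) ?elt_gen_sub.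
Qed.

(** An abelian [elt_gen2 A] is an [r']-group. Each [v] of order [r] in [B] normalizes it, and it
    normalizes [<[v]>], so they commute. It thus has nontrivial fixed points on every nontrivial
    cyclic [r]-subgroup of [B], hence acts trivially there. *)
Lemma tp_abelian_elt_gen2_cent A B :
    totally_permutable A B -> {in \pi(A), forall s, s <= r} -> {in \pi(B), forall s, s <= r} ->
    ~~ r.-group (elt_gen r A) -> abelian (elt_gen2 A) ->
  elt_gen2 A \subset 'C(B).
Proof.
move=> tAB maxA maxB r'T abK.
have r'K : r^'.-group (elt_gen2 A).
  suffices sKO : elt_gen2 A \subset 'O_r^'(elt_gen2 A) by apply: pgroupS sKO (pcore_pgroup _ _).
  apply/elt_gen_subP=> x Tx r'x.
  have hallO := nilpotent_pcore_Hall r^' (abelian_nil abK).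
  by rewrite (mem_normal_Hall hallO) ?pcore_normal // mem_elt_gen.
have cent_order v : v \in B -> #[v] = r -> v \in 'C(elt_gen2 A).
  move=> Bv ov; have rv : r.-elt v by rewrite /p_elt ov pnat_id.
  have nTv : v \in 'N(elt_gen r A).
    apply: elt_gen_norm_cycles => x Ax rx.
    by apply: (order_p_norm_pgroup _ pr_r ov); rewrite ?(tAB <[x]>%G <[v]>%G) ?cycle_subG.
  have nKv : <[v]> \subset 'N(elt_gen2 A).
    by rewrite cycle_subG (subsetP (elt_gen_norm _ _)).
  rewrite -cycle_subG; apply/commG1P/trivgP.
  have <-: elt_gen2 A :&: <[v]> = 1 by rewrite coprime_TIg // coprime_sym (pnat_coprime rv).
  by rewrite subsetI commg_subr nKv commg_subl (tp_elt_gen2_norm_cycle tAB maxA Bv rv).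
apply/elt_gen_subP=> k Tk r'k; have Kk := mem_elt_gen Tk r'k.
apply/centP=> b Bb; rewrite -(consttC r b); apply: commuteM; last first.
  have cbT := tp_cent_elt_gen tAB maxB (groupX _ Bb) (p_elt_constt r^' b) r'T.
  by apply: commute_sym; apply: (centP cbT).
set v := b.`_r; have Bv : v \in B by apply: groupX.
have rv : r.-elt v := p_elt_constt r b.
apply/commute_sym/commgP/contraT=> nt_vk.
have nvk := subsetP (tp_elt_gen2_norm_cycle tAB maxA Bv rv) k Kk.
have TI := cyclic_cent1_TI pr_r rv r'k nvk nt_vk.
have ntv : <[v]> != 1
  by apply: contraNneq nt_vk => /eqP; rewrite cycle_eq1 => /eqP->; rewrite comm1g.
have [_ r_dv_v _] := pgroup_pdiv rv ntv.
have [z vz oz] := Cauchy pr_r r_dv_v.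
have Bz : z \in B by apply: subsetP vz; rewrite cycle_subG.
have : z \in 'C_<[v]>[k]
  by rewrite inE vz; apply/cent1P; apply: (centP (cent_order z Bz oz)).
by rewrite TI => /set1P z1; move: (prime_gt1 pr_r); rewrite -oz z1 order1.
Qed.

Lemma elt_gen_trivial_pgroup T : elt_gen r^' T :=: 1 -> r.-group T.
Proof.
move=> K1; apply/pgroupP=> p pr_p /(Cauchy pr_p)[x Tx ox]; apply: contraT => r'p.
have r'x : r^'.-elt x by rewrite /p_elt ox pnatE.
have := mem_elt_gen Tx r'x; rewrite K1 => /set1P x1.
by move: (prime_gt1 pr_p); rewrite -ox x1 order1.
Qed.

End TotallyPermutablePair.

(** * Factorizations into several totally permutable subgroups *)

Section TotallyPermutableFactorizations.

Implicit Types gT : finGroupType.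

Definition tp_factorization gT (G : {group gT}) n (Gs : 'I_n -> {group gT}) :=
  [/\ forall i, Gs i \subset G,
      (G : {set gT}) = \prod_(i < n) (Gs i : {set gT}) &
      forall i j, i != j -> totally_permutable (Gs i) (Gs j)].

Lemma permutable_prod_pgroup gT (pi : nat_pred) n (H : 'I_n -> {group gT}) :
    (forall i j, H i * H j = H j * H i) -> (forall i, pi.-group (H i)) ->
  exists K : {group gT},
    [/\ (K : {set gT}) = \prod_(i < n) (H i : {set gT}), pi.-group K &
        forall i, H i \subset K].
Proof.
elim: n => [|n IHn] in H * => cHH piH.
  by exists 1%G; split; rewrite ?big_ord0 ?pgroup1 // => -[].
have [|| K [defK piK sHK]] := IHn (fun i => H (widen_ord (leqnSn n) i)) => //.
have cKH : K * H ord_max = H ord_max * K.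
  rewrite defK; elim/big_ind: _ => [|X Y cX cY|i _]; rewrite ?mulg1 ?mul1g //.
  by rewrite -mulgA cY mulgA cX mulgA.
have gM : K <*> H ord_max = K * H ord_max by rewrite comm_joingE.
exists (K <*> H ord_max)%G; split => [||i].
- by rewrite big_ord_recr /= gM defK.
- by rewrite /= gM pgroupM piK piH.
have [ltin | leni] := ltnP i n.
  have -> : i = widen_ord (leqnSn n) (Ordinal ltin) by apply: val_inj.
  exact: subset_trans (sHK _) (joing_subl _ _).
have -> : i = ord_max by apply/val_inj/anti_leq; rewrite -ltnS ltn_ord.
exact: joing_subr.
Qed.

Lemma tp_factorization_sub gT (G H : {group gT}) n (Gs : 'I_n -> {group gT}) :
  tp_factorization G Gs -> (forall i, Gs i \subset H) -> G \subset H.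
Proof.
case=> _ -> _ sGH; elim/big_ind: _ => [|X Y|i _ //]; first exact: sub1G.
exact: mul_subG.
Qed.

Lemma tp_factorization_pgroup gT (pi : nat_pred) (G : {group gT}) n (Gs : 'I_n -> {group gT}) :
  tp_factorization G Gs -> (forall i, pi.-group (Gs i)) -> pi.-group G.
Proof.
case=> _ defG tG piG; have [|K [defK piK _]] := permutable_prod_pgroup _ piG.
  by move=> i j; have [-> // | /tG] := eqVneq i j; apply.
by rewrite /pgroup defG -defK.
Qed.

Lemma tp_factorization_quotient gT (K G : {group gT}) n (Gs : 'I_n -> {group gT}) :
    G \subset 'N(K) -> tp_factorization G Gs ->
  tp_factorization (G / K)%G (fun i => Gs i / K)%G.
Proof.
move=> nKG [sG defG tG]; have nKGs i := subset_trans (sG i) nKG.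
split=> [i||i j /tG tij X Y sXi sYj]; first exact: quotientS.
  rewrite /= defG; elim/big_rec2: _ => [|i X Y _ <-]; first exact: quotient1.
  by rewrite quotientMl.
pose X' := [group of Gs i :&: coset K @*^-1 X].
pose Y' := [group of Gs j :&: coset K @*^-1 Y].
have defX : X' / K = X by rewrite /= quotient_setIpre; apply/setIidPr.
have defY : Y' / K = Y by rewrite /= quotient_setIpre; apply/setIidPr.
have sX'i : X' \subset Gs i := subsetIl _ _.
have sY'j : Y' \subset Gs j := subsetIl _ _.
rewrite -defX -defY -!quotientMl ?(subset_trans sX'i) ?(subset_trans sY'j) //.
by rewrite tij.
Qed.

(* The core is needed: [C_A(B)] need not be normal in [A]. *)
Definition cofactor_core gT n (Gs : 'I_n -> {group gT}) i : {group gT} :=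
  (gcore 'C_(Gs i)(\bigcup_(j < n | j != i) Gs j) (Gs i))%G.

Lemma cofactor_core_sub gT n (Gs : 'I_n -> {group gT}) i : cofactor_core Gs i \subset Gs i.
Proof. by rewrite (subset_trans (gcore_sub _ _)) ?subsetIl. Qed.

Lemma cofactor_core_max gT n (Gs : 'I_n -> {group gT}) i (H : {group gT}) :
    H <| Gs i -> (forall j, j != i -> H \subset 'C(Gs j)) ->
  H \subset cofactor_core Gs i.
Proof.
case/andP=> sHi nHi cHj; rewrite gcore_max // subsetI sHi centsC.
by apply/bigcupsP=> j ne_ji; rewrite centsC cHj.
Qed.

Lemma cofactor_core_cent gT n (Gs : 'I_n -> {group gT}) i j :
  j != i -> Gs j \subset 'C(cofactor_core Gs i).
Proof.
move=> ne_ji; rewrite centsC (subset_trans (gcore_sub _ _)) // subIset //.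
by rewrite centS ?orbT // (bigcup_sup j).
Qed.

(** [Gs i] normalizes its cofactor core and the other factors centralize it. So [G] induces on the
    core only automorphisms induced by [Gs i]. *)
Lemma cofactor_core_normal gT (G : {group gT}) n (Gs : 'I_n -> {group gT}) i :
  tp_factorization G Gs ->
  cofactor_core Gs i <| G /\ G \subset Gs i * 'C_G(cofactor_core Gs i).
Proof.
move=> tpG; have [sG _ _] := tpG; set K := cofactor_core Gs i.
have sKi : K \subset Gs i := cofactor_core_sub Gs i.
have nKG : G \subset 'N(K).
  apply: (tp_factorization_sub tpG (H := 'N(K)%G)) => j; have [-> | ne_ji] := eqVneq j i.
    exact: gcore_norm.
  by rewrite /= cents_norm // cofactor_core_cent.
have nsC : 'C_G(K) <| G.
  by rewrite /normal subsetIl normsI ?normG // (subset_trans nKG) ?cent_norm.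
split; first by rewrite /normal nKG (subset_trans sKi).
rewrite -norm_joinEl ?(subset_trans (sG i)) ?normal_norm //.
apply: (tp_factorization_sub tpG) => j; have [-> | ne_ji] := eqVneq j i.
  exact: joing_subl.
by apply: subset_trans (joing_subr _ _); rewrite subsetI sG cofactor_core_cent.
Qed.

(** * The Sylow subgroup for the largest prime divisor *)

Section LargestPrime.

Variables (gT : finGroupType) (r : nat) (G : {group gT}) (n : nat).
Variable Gs : 'I_n -> {group gT}.
Hypotheses (pr_r : prime r) (tpG : tp_factorization G Gs).
Hypothesis max_r : {in \pi(G), forall s, s <= r}.

Let max_ri i : {in \pi(Gs i), forall s, s <= r}.
Proof. by case: tpG => sG _ _ s /(piSg (sG i)); apply: max_r. Qed.

(** Otherwise the derived subgroup of [K] lies in the trivial cofactor core, so [K] is abelian; then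
    [K] itself lies there, and [elt_gen r (Gs i)] has no nontrivial [r']-elements. *)
Lemma cofactor_core1_pgroup i : cofactor_core Gs i :=: 1 -> r.-group (elt_gen r (Gs i)).
Proof.
case: tpG => _ _ tG Ci1; apply: contraT => r'T.
pose K := elt_gen r^' (elt_gen r (Gs i)).
have nsKi : K <| Gs i.
  rewrite /normal (subset_trans (elt_gen_sub _ _)) ?elt_gen_sub //.
  by rewrite (subset_trans (normG _)) // (subset_trans (elt_gen_norm r _)) ?elt_gen_norm.
have tij j : j != i -> totally_permutable (Gs i) (Gs j) by rewrite eq_sym => /tG.
have abK : abelian K.
  apply/derG1P/trivgP; rewrite -Ci1.
  rewrite cofactor_core_max ?(char_normal_trans (der_char 1 _)) // => j /tij tGj.
  exact: tp_der_elt_gen2_cent tGj (@max_ri i) (@max_ri j) r'T.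
case/negP: (r'T); apply: elt_gen_trivial_pgroup; apply/trivgP.
rewrite -Ci1 cofactor_core_max // => j /tij tGj.
exact: tp_abelian_elt_gen2_cent tGj (@max_ri i) (@max_ri j) r'T abK.
Qed.

Let T : {group gT} := <<\bigcup_(i < n) elt_gen r (Gs i)>>%G.

Let sTi i : elt_gen r (Gs i) \subset T.
Proof. by rewrite sub_gen // (bigcup_max i). Qed.

(** The [r]-part of an element of [Gs j] lies in [T]. Its [r']-part normalizes [elt_gen r (Gs j)]
    and all cyclic [r]-subgroups of the other factors. *)
Lemma elt_gen_join_normal : T <| G.
Proof.
case: tpG => sG _ tG.
rewrite /normal gen_subG; apply/andP; split.
  by apply/bigcupsP=> i _; apply: subset_trans (elt_gen_sub _ _) (sG i).
apply: (tp_factorization_sub tpG) => j; apply/subsetP=> y Gy.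
rewrite -(consttC r y) groupM //.
  apply: (subsetP (normG T)); apply: (subsetP (sTi j)).
  by rewrite mem_elt_gen ?groupX ?p_elt_constt.
set z := y.`_r^'; have Gz : z \in Gs j by apply: groupX.
have r'z : r^'.-elt z := p_elt_constt r^' y.
rewrite -cycle_subG norms_gen // norms_bigcup //; apply/bigcapsP=> i _.
rewrite cycle_subG; have [-> | ne_ij] := eqVneq i j.
  by apply: (subsetP (elt_gen_norm _ _)); apply: (subsetP (normG _)).
apply: elt_gen_norm_cycles => x Gx rx.
exact: tp_norm_cycle (tG _ _ ne_ij) (@max_ri j) Gx rx Gz r'z.
Qed.

(** [T] lies in the product of the permuting [r]-groups [elt_gen r (Gs i)]. Modulo [T] every factor
    becomes an [r']-group, hence so does [G]. *)
Lemma elt_gen_join_Sylow :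
  (forall i, cofactor_core Gs i :=: 1) -> r.-Sylow(G) T.
Proof.
move=> C1; have [sG _ tG] := tpG; have /andP[sTG nTG] := elt_gen_join_normal.
have rT i : r.-group (elt_gen r (Gs i)) by apply: cofactor_core1_pgroup.
have [|K [_ rK sTK]] := permutable_prod_pgroup _ rT.
  by move=> i j; have [-> // | /tG] := eqVneq i j; apply; apply: elt_gen_sub.
rewrite /pHall sTG -card_quotient //=; apply/andP; split.
  by apply: (pgroupS _ rK); rewrite gen_subG; apply/bigcupsP=> i _; apply: sTK.
apply: (tp_factorization_pgroup (tp_factorization_quotient nTG tpG)) => i.
apply/pi'_quotientP; first exact: subset_trans nTG.
by move=> x Gx rx; apply: (subsetP (sTi i)); rewrite mem_elt_gen.
Qed.

Lemma elt_gen_join_cent (q : nat) y :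
    q < r -> ~~ (q %| r.-1) ->
    (forall i z, z \in Gs i -> q.-elt z -> z \in 'C(elt_gen r (Gs i))) ->
    y \in G -> q.-elt y ->
  y \in 'C(T).
Proof.
move=> ltqr q'r1 cqT Gy qy; have [sG _ tG] := tpG.
have nCG : G \subset 'N('C(T)).
  by rewrite (subset_trans (normal_norm elt_gen_join_normal)) ?cent_norm.
have q'GC : q^'.-group (G / 'C(T)).
  apply: (tp_factorization_pgroup (tp_factorization_quotient nCG tpG)) => j.
  apply/pi'_quotientP; first exact: subset_trans nCG.
  move=> z Gz qz; rewrite /= -sub_cent1 gen_subG; apply/bigcupsP=> i _.
  have [-> | ne_ij] := eqVneq i j; first by rewrite sub_cent1 cqT.
  rewrite gen_subG; apply/subsetP=> x; rewrite inE => /andP[Gx rx].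
  have r'z : r^'.-elt z by apply: sub_p_elt qz => s /eqnP->; rewrite !inE /= neq_ltn ltqr.
  have nz w : w \in Gs i -> r.-elt w -> z \in 'N(<[w]>).
    by move=> Gw rw; apply: tp_norm_cycle (tG _ _ ne_ij) (@max_ri j) Gw rw Gz r'z.
  (* If [z] did not commute with [x], it would fix no nontrivial element of [<[x]>]; but it
     centralizes the subgroup of order [r], as [q] does not divide [r.-1]. *)
  apply/cent1P/commgP/contraT=> ntxz.
  have TI := cyclic_cent1_TI pr_r rx r'z (nz x Gx rx) ntxz.
  have ntx : <[x]> != 1
    by apply: contraNneq ntxz => /eqP; rewrite cycle_eq1 => /eqP->; rewrite comm1g.
  have [_ r_dv_x _] := pgroup_pdiv rx ntx.
  have [w xw ow] := Cauchy pr_r r_dv_x.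
  have sxG : <[x]> \subset Gs i by rewrite cycle_subG.
  have rw : r.-elt w by rewrite /p_elt ow pnat_id.
  have nwz : <[z]> \subset 'N(<[w]>) by rewrite cycle_subG nz ?(subsetP sxG).
  have := pgroup_cent_prime pr_r ow qz q'r1 nwz; rewrite cycle_subG => czw.
  have : w \in 'C_<[x]>[z] by rewrite inE xw -cycle_subG sub_cent1.
  by rewrite TI => /set1P w1; move: (prime_gt1 pr_r); rewrite -ow w1 order1.
exact: (pi'_quotientP _ nCG q'GC).
Qed.

End LargestPrime.

End TotallyPermutableFactorizations.

(** * Induction for classes of groups without a given edge *)

Section ClosedClasses.

Variables (p q : nat) (F : forall gT : finGroupType, {group gT} -> bool).
Implicit Types gT : finGroupType.

(** [F] ranges over all group types so that induction can pass to quotients. [class_central_prod]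
    serves a nontrivial cofactor core, with [A] the factor containing it; [class_p'_extension]
    serves a normal Sylow [r]-subgroup with [r <> p]; the last two fields serve [r = p]. *)
Record edge_free_class : Prop := EdgeFreeClass {
  class_quotient : forall gT (K G : {group gT}), G \subset 'N(K) -> F G -> F (G / K);
  class_central_prod : forall gT (K A G : {group gT}),
    K <| G -> K \subset A -> A \subset G -> G \subset A * 'C_G(K) ->
    F A -> F (G / K) -> F G;
  class_p'_extension : forall gT (K G : {group gT}),
    K <| G -> p^'.-group K -> F (G / K) -> F G;
  class_normal_Sylow_cent : forall gT (P G : {group gT}),
    q != p -> P <| G -> p.-Sylow(G) P -> F G ->
    forall y, y \in G -> q.-elt y -> y \in 'C(P);
  class_normal_Sylow : forall gT (P G : {group gT}),
    P <| G -> p.-Sylow(G) P ->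
    (q != p -> forall y, y \in G -> q.-elt y -> y \in 'C(P)) -> F G
}.

Theorem tp_factorization_class gT (G : {group gT}) n (Gs : 'I_n -> {group gT}) :
    edge_free_class -> prime p -> prime q -> ~~ (q %| p.-1) ->
    tp_factorization G Gs -> (forall i, F (Gs i)) ->
  F G.
Proof.
move=> classF pr_p pr_q q'p1; have [m] := ubnP #|G|.
elim: m => // m IHm in gT G Gs *; rewrite ltnS => leGm tpG FGs.
have [G1 | ntG] := eqVneq (G : {set gT}) 1.
  apply: (class_normal_Sylow classF (P := G)) => // [|_ y].
    by rewrite /pHall subxx indexgg G1 pgroup1.
  by rewrite G1 => /set1P-> _; apply: group1.
have quoF (K : {group gT}) : K <| G -> K :!=: 1 -> F (G / K).
  case/andP=> sKG nKG ntK; apply: (IHm _ _ (fun i => Gs i / K)%G).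
  - by apply: leq_trans leGm; apply: ltn_quotient.
  - exact: tp_factorization_quotient.
  by move=> i; apply: (class_quotient classF) => //; apply: subset_trans nKG; case: tpG.
have [allC1 | ] := boolP [forall i, cofactor_core Gs i :==: 1]; last first.
  rewrite negb_forall => /existsP[i ntCi].
  have [nsCiG sGCi] := cofactor_core_normal i tpG; have [sG _ _] := tpG.
  by apply: (class_central_prod classF nsCiG (cofactor_core_sub Gs i)) => //; apply: quoF.
have {}allC1 i : cofactor_core Gs i :=: 1 by apply/eqP/(forallP allC1).
set r := max_pdiv #|G|.
have pr_r : prime r by rewrite max_pdiv_prime // cardG_gt1.
have max_r : {in \pi(G), forall s, s <= r} by move=> s; apply: max_pdiv_max.
have nsTG := elt_gen_join_normal pr_r tpG max_r.
have sylT := elt_gen_join_Sylow pr_r tpG max_r allC1.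
set T := <<_>>%G in nsTG sylT.
have [eq_rp | ne_rp] := eqVneq r p; last first.
  apply: (class_p'_extension classF nsTG).
    by apply: sub_pgroup (pHall_pgroup sylT) => s /eqnP->.
  apply: quoF nsTG _; apply: contraNneq ntG => T1.
  have := card_Hall sylT; rewrite T1 cards1 => /esym/eqP; rewrite partG_eq1 p'groupEpi.
  by rewrite mem_primes pr_r cardG_gt0 max_pdiv_dvd.
clearbody r; subst r; apply: (class_normal_Sylow classF nsTG sylT) => ne_qp y Gy qy.
have [-> | nty] := eqVneq y 1; first exact: group1.
(* [q] divides [#|G|], whose largest prime divisor is now [p]. *)
have ltqp : q < p.
  rewrite ltn_neqAle ne_qp max_r // mem_primes pr_q cardG_gt0.
  by apply: dvdn_trans (order_dvdG Gy); have [] := pgroup_pdiv (G := <[y]>) qy; rewrite ?cycle_eq1.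
apply: (elt_gen_join_cent pr_r tpG max_r ltqp q'p1 _ Gy qy) => i z Gz qz.
have sGi : Gs i \subset G by case: tpG.
have sylTi := setI_normal_Hall nsTG sylT sGi.
have nsTi : [group of T :&: Gs i] <| Gs i.
  by rewrite /normal subsetIr normsI ?normG // (subset_trans sGi) ?normal_norm.
have := class_normal_Sylow_cent classF ne_qp nsTi sylTi (FGs i) Gz qz.
apply: subsetP; rewrite centS // subsetI elt_gen_sub andbT sub_gen //.
exact: (bigcup_sup i).
Qed.

End ClosedClasses.

(** * The classes defined by missing edges *)

Section EdgeFreeClasses.

Variables (p q : nat).
Implicit Types gT : finGroupType.

(** The flag [b] lets one argument treat Sylow subgroups and arbitrary [p]-subgroups together. *)
Definition psub (b : bool) gT (G P : {group gT}) : bool :=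
  [&& P \subset G, p.-group P & b ==> p.-Sylow(G) P].

(* No edge [(p, q)] in the N-critical graph ([b = false]), in the Sylow graph ([b = true]). *)
Definition norm_cent (b : bool) gT (G : {group gT}) : bool :=
  [forall P : {group gT}, forall y, [&& psub b G P, y \in 'N_G(P) & q.-elt y] ==> (y \in 'C(P))].

Lemma norm_centP b gT (G : {group gT}) :
  reflect (forall (P : {group gT}) y, psub b G P -> y \in 'N_G(P) -> q.-elt y -> y \in 'C(P))
          (norm_cent b G).
Proof.
apply: (iffP forallP) => [FG P y PG ny qy | FG P].
  by have /forallP/(_ y)/implyP := FG P; apply; rewrite PG ny.
by apply/forallP=> y; apply/implyP=> /and3P[]; apply: FG.
Qed.

Lemma psub_quotient b gT (K G P : {group gT}) :
  G \subset 'N(K) -> psub b G P -> psub b (G / K) (P / K).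
Proof.
move=> nKG /and3P[sPG pP sylP]; rewrite /psub quotientS ?quotient_pgroup //=.
by case: b sylP => //= /quotient_pHall-> //; apply: subset_trans nKG.
Qed.

(** [P] is a Sylow [p]-subgroup, containing [S], of the preimage [M] of [PK] in [A]. By the Frattini
    argument a preimage of [yK] is [m * w] with [m] in [M] and [w] normalizing [P]; replace [m] by
    an element of [P] in the same coset and take the [q]-part. *)
Lemma psub_lift b gT (K A S : {group gT}) (PK : {group coset_of K}) yK :
    A \subset 'N(K) -> psub b (A / K) PK -> yK \in 'N_(A / K)(PK) -> q.-elt yK ->
    S \subset A -> p.-group S -> S / K \subset PK ->
  exists (P : {group gT}) y,
    [/\ psub b A P, P / K = PK & S \subset P] /\
    [/\ y \in 'N_A(P), q.-elt y & coset K y = yK].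
Proof.
move=> nKA /and3P[sPKA pPK sylPK] /setIP[AyK nPKy] qy sSA pS sSP.
pose M := [group of A :&: coset K @*^-1 PK].
have sMA : M \subset A := subsetIl _ _.
have nKM := subset_trans sMA nKA.
have defMK : M / K = PK by rewrite /= quotient_setIpre; apply/setIidPr.
have sSM : S \subset M.
  by rewrite subsetI sSA -sub_quotient_pre ?(subset_trans sSA).
have [P sylP sSPP] := Sylow_superset sSM pS.
have sPM := pHall_sub sylP; have pP := pHall_pgroup sylP.
have defPK : P / K = PK.
  rewrite -defMK; apply: (@pHall_id _ p (P / K)%G (M / K)%G); last by rewrite /= defMK.
  by apply: quotient_pHall => //; apply: subset_trans nKM.
have psubP : psub b A P.
  rewrite /psub (subset_trans sPM) //= pP /=; apply/implyP=> bT.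
  rewrite /pHall (subset_trans sPM) // pP /= -(Lagrange_index sMA sPM) pnatM.
  have /and3P[_ _ ->] := sylP; rewrite andbT -(index_quotient_eq _ sMA nKA).
    by rewrite defMK; move: sylPK; rewrite bT => /and3P[].
  by rewrite setIS ?sub_cosetpre.
have [y nKy Ay def_y] := morphimP AyK.
have nMy : y \in 'N_A(M).
  rewrite inE Ay /= -cycle_subG normsI //; first by rewrite cycle_subG (subsetP (normG A)).
  rewrite cycle_subG (subsetP (morphpre_norm _ _)) //.
  by rewrite mem_morphpre //= -def_y.
have nsMN : M <| 'N_A(M) by rewrite /normal subsetI sMA normG subsetIr.
have := nMy; rewrite -{1}(Frattini_arg nsMN sylP).
case/mulsgP=> [m w Mm /setIP[/setIP[Aw _] nPw] def_mw].
have: coset K m \in P / K by rewrite defPK -defMK mem_quotient.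
case/morphimP=> u nKu Pu eq_mu.
have nw : u * w \in 'N_A(P).
  rewrite groupM //; last by rewrite inE Aw.
  by rewrite inE (subsetP (normG P)) // (subsetP sMA) ?(subsetP sPM).
have nKw := subsetP nKA w Aw.
exists P, (u * w).`_q; split=> //; split; rewrite ?groupX ?p_elt_constt //.
have nKm := subsetP nKM m Mm.
rewrite morph_constt ?groupM // morphM // -eq_mu -morphM // -def_mw -def_y.
exact: constt_p_elt.
Qed.

(** Each [[~ x, y]] with [x] in [P] lies in [P :&: K], so commutes with [y], and its order divides
    [#[y]]. Being also a [p]-element, it is trivial. *)
Lemma coset_cent_ext gT (K P : {group gT}) y :
    p != q -> P \subset 'N(K) -> y \in 'N(K) -> p.-group P -> q.-elt y -> y \in 'N(P) ->
    coset K y \in 'C(P / K) -> y \in 'C(P :&: K) ->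
  y \in 'C(P).
Proof.
move=> ne_pq nKP nKy pP qy nPy cPKy cSy.
have sRS : [~: P, <[y]>] \subset P :&: K.
  rewrite subsetI commg_subl cycle_subG nPy -quotient_cents2 ?cycle_subG //.
  by rewrite quotient_cycle // centsC cycle_subG.
apply/centP=> x Px; apply/commute_sym/commgP.
have /setIP[Pxy Kxy] := subsetP sRS _ (mem_commg Px (cycle_id y)).
have cyxy : commute y [~ x, y] by apply: (centP cSy); rewrite inE Pxy.
have oxy : #[[~ x, y]] %| #[y] by rewrite order_dvdn -commgX // expg_order commg1.
rewrite -order_eq1; apply/eqP/(@pnat_1 p); first exact: mem_p_elt pP Pxy.
by apply: (pnat_dvd oxy); apply: sub_p_elt qy => s /eqnP->; rewrite !inE /= eq_sym.
Qed.

Lemma norm_cent_class b : p != q -> edge_free_class p q (@norm_cent b).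
Proof.
move=> ne_pq; split=> gT.
- move=> K G nKG /norm_centP FG; apply/norm_centP=> PK yK psubP ny qy.
  have [||| P [y [[psP defP _] [ny' qy' defy]]]] := psub_lift (S := 1%G) nKG psubP ny qy.
  - exact: sub1G.
  - exact: pgroup1.
  - by rewrite quotient1 sub1G.
  have cPy := FG P y psP ny' qy'.
  rewrite -defy -defP -cycle_subG -quotient_cycle; last by case/setIP: ny' => /(subsetP nKG).
  by rewrite quotient_cents // cycle_subG.
- move=> K A G nsKG sKA sAG sGAC /norm_centP FA /norm_centP FGK; apply/norm_centP=> P y psP ny qy.
  have [Gy nPy] := setIP ny; have /and3P[sPG pP _] := psP.
  have nKG := normal_norm nsKG.
  pose C := [group of 'C_G(K)].
  have nCG : G \subset 'N(C) by rewrite normsI ?normG // (subset_trans nKG) ?cent_norm.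
  have eqAG : (A / C = G / C)%G.
    apply/val_inj/eqP; rewrite eqEsubset /= quotientS //=.
    by rewrite -(@quotientMidr _ C A) quotientS.
  have nCA := subset_trans sAG nCG.
  have sSA : P :&: K \subset A by rewrite subIset ?sKA ?orbT.
  (* [A] and [G] have the same image modulo [C], so [y] has a counterpart [z] in [A] centralizing
     some [PA] that contains [P :&: K]. As [y * z^-1] centralizes [K], [y] centralizes [P :&: K]
     too. *)
  have [|||||| PA [z [[psPA _ sSPA] [nz qz eq_zy]]]] :=
      @psub_lift b _ C A [group of P :&: K] (P / C)%G (coset C y) nCA.
  - by rewrite eqAG psub_quotient.
  - rewrite inE [A / C](congr1 val eqAG) mem_quotient //=.
    by rewrite (subsetP (quotient_norm _ _)) // mem_quotient.
  - by apply: morph_p_elt; rewrite ?(subsetP nCG).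
  - exact: sSA.
  - by apply: pgroupS pP; apply: subsetIl.
  - by rewrite quotientS ?subsetIl.
  have cPAz := FA PA z psPA nz qz; have [Az _] := setIP nz.
  apply: (coset_cent_ext (K := K) ne_pq) => //; rewrite ?(subset_trans sPG) ?(subsetP nKG) //.
    apply: (FGK (P / K)%G); first exact: psub_quotient.
      by rewrite inE mem_quotient //= (subsetP (quotient_norm _ _)) // mem_quotient.
    by apply: morph_p_elt; rewrite ?(subsetP nKG).
  rewrite -(mulgKV z y) groupM //; last by rewrite (subsetP _ _ cPAz) // centS.
  have : y * z^-1 \in C.
    have [nCy nCz] := (subsetP nCG y Gy, subsetP nCA z Az).
    by apply: coset_idr; rewrite ?groupM ?groupV // morphM ?morphV ?groupV //= eq_zy mulgV.
  by case/setIP=> _; apply: subsetP; rewrite centS ?subsetIr.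
- move=> K G nsKG p'K /norm_centP FGK; apply/norm_centP=> P y psP ny qy.
  have nKG := normal_norm nsKG; have [Gy nPy] := setIP ny; have /and3P[sPG pP _] := psP.
  apply: (coset_cent_ext (K := K) ne_pq) => //; rewrite ?(subset_trans sPG) ?(subsetP nKG) //.
    apply: (FGK (P / K)%G); first exact: psub_quotient.
      by rewrite inE mem_quotient //= (subsetP (quotient_norm _ _)) // mem_quotient.
    by apply: morph_p_elt; rewrite ?(subsetP nKG).
  by rewrite (coprime_TIg (pnat_coprime pP p'K)) cent1T inE.
- move=> P G _ nsPG sylP /norm_centP FG y Gy qy; apply: FG => //.
    by rewrite /psub (pHall_sub sylP) (pHall_pgroup sylP) sylP implybT.
  by rewrite inE Gy (subsetP (normal_norm nsPG)).
move=> P G nsPG sylP cPq; apply/norm_centP=> P1 y /and3P[sP1G pP1 _] /setIP[Gy _] qy.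
have : y \in 'C(P) by apply: cPq; rewrite // eq_sym.
by apply: subsetP; rewrite centS // (sub_normal_Hall sylP).
Qed.

(* [O^p(O^q'(G))], whose being a [p']-group means that [O^q'(G)] is [p]-nilpotent, i.e.
   contained in [O_{p',p}(G)]: no edge [(p, q)] in the Hawkes graph. *)
Definition residual gT (G : {group gT}) := elt_gen p^' (elt_gen q G).

Lemma residual_normal gT (G : {group gT}) : residual G <| G.
Proof.
rewrite /normal (subset_trans (elt_gen_sub _ _)) ?elt_gen_sub //.
by rewrite (subset_trans (normG _)) // (subset_trans (elt_gen_norm q _)) ?elt_gen_norm.
Qed.

Lemma residual_quotient gT (K G : {group gT}) :
  G \subset 'N(K) -> residual (G / K) = (residual G / K)%G.
Proof.
move=> nKG; rewrite /residual !elt_gen_quotient //.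
by rewrite (subset_trans (elt_gen_sub _ _)).
Qed.

(** A Sylow [p]-subgroup of [W] lies in [S], so it is central in [W]; by Schur-Zassenhaus [W] has a
    normal [p]-complement, which contains all its [p']-elements. *)
Lemma elt_gen_p'group gT (W : {group gT}) (S : {set gT}) :
    (forall x, x \in W -> p.-elt x -> x \in S) -> W \subset 'C(S) ->
  p^'.-group (elt_gen p^' W).
Proof.
move=> sWS cSW; have [P sylP] := Sylow_exists p W.
have sPW := pHall_sub sylP; have pP := pHall_pgroup sylP.
have cPW : W \subset 'C(P).
  apply: subset_trans cSW _; apply: centS; apply/subsetP=> x Px.
  by rewrite sWS ?(subsetP sPW) ?(mem_p_elt pP).
have nsPW : P <| W by rewrite /normal sPW cents_norm.
have /splitsP[X /complP[tiPX defW]] := SchurZassenhaus_split (pHall_Hall sylP) nsPW.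
have sXW : X \subset W by rewrite -defW mulG_subr.
have nsXW : X <| W.
  by rewrite /normal sXW -defW mul_subG ?normG // cents_norm // centsC (subset_trans sXW).
have [_ p'X] : p.-Hall(W) P /\ p^'.-group X.
  split=> //; have /and3P[_ _] := sylP.
  by rewrite -divgS // -defW TI_cardMg // mulKn.
apply: pgroupS p'X; apply/elt_gen_subP; apply/pi'_quotientP; first exact: normal_norm.
rewrite pgroupNK -defW quotientMidr; exact: quotient_pgroup.
Qed.

Lemma residual_idem gT (G : {group gT}) : elt_gen p^' (residual G) = residual G.
Proof.
apply/val_inj/eqP; rewrite eqEsubset /= elt_gen_sub.
by apply/elt_gen_subP=> x Ex p'x; do 2!apply: mem_elt_gen => //.
Qed.

Lemma residual_class : edge_free_class p q (fun gT G => p^'.-group (@residual gT G)).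
Proof.
split=> gT.
- by move=> K G nKG p'W; rewrite residual_quotient ?quotient_pgroup.
- move=> K A G nsKG sKA sAG sGAC p'WA; have nKG := normal_norm nsKG.
  rewrite residual_quotient // => p'WK.
  pose C := [group of 'C_G(K)].
  have nCG : G \subset 'N(C) by rewrite normsI ?normG // (subset_trans nKG) ?cent_norm.
  have eqAG : (A / C = G / C)%G.
    apply/val_inj/eqP; rewrite eqEsubset /= quotientS //=.
    by rewrite -(@quotientMidr _ C A) quotientS.
  have sWG := normal_sub (residual_normal G).
  have nCA := subset_trans sAG nCG.
  have eqW : residual A / C = residual G / C.
    by rewrite -[LHS]/(gval (residual A / C)%G) -residual_quotient // eqAG residual_quotient.
  have nsZG : K :&: C <| G by rewrite normalI // /normal nCG subsetIl.
  have abZ : abelian (K :&: C).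
    apply: subset_trans (subsetIr K C) (subset_trans (subsetIr _ _) _).
    by rewrite centS ?subsetIl.
  pose S := 'O_p(K :&: C)%G.
  have sSK : S \subset K by rewrite (subset_trans (pcore_sub _ _)) ?subsetIl.
  have nsSG : S <| G := char_normal_trans (pcore_char _ _) nsZG.
  (* The [p]-elements of [residual G] lie in [K] and in [C], both quotients being [p']-groups, hence
     in [S]. For centralizing [S], use [C * residual A]: [C] centralizes [K], while [residual A] and
     [S] normalize each other and have coprime orders. *)
  rewrite -residual_idem; apply: (@elt_gen_p'group _ _ S) => [x Wx px|].
    rewrite (mem_normal_Hall (nilpotent_pcore_Hall p (abelian_nil abZ))) ?pcore_normal // inE.
    have p'WC : p^'.-group (residual G / C) by rewrite -eqW quotient_pgroup.
    rewrite (pi'_quotientP _ (subset_trans sWG nKG) p'WK) //.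
    exact: (pi'_quotientP _ (subset_trans sWG nCG) p'WC).
  have sWA : residual G \subset C * residual A.
    by rewrite -quotientSK ?(subset_trans sWG) // eqW.
  apply: subset_trans sWA _; rewrite mul_subG //.
    by rewrite (subset_trans (subsetIr _ _)) // centS.
  have nsWA := residual_normal A.
  apply/commG1P/trivgP; rewrite -(coprime_TIg (pnat_coprime (pcore_pgroup _ _ : p.-group S) p'WA)).
  rewrite subsetI commg_subr commg_subl; apply/andP; split.
    exact: subset_trans (normal_sub nsWA) (subset_trans sAG (normal_norm nsSG)).
  exact: subset_trans sSK (subset_trans sKA (normal_norm nsWA)).
- move=> K G nsKG p'K; have nKG := normal_norm nsKG.
  rewrite residual_quotient // pquotient_pgroup //.
  by rewrite (subset_trans (normal_sub (residual_normal G))).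
- move=> P G ne_qp nsPG sylP p'W y Gy qy.
  have Wy : y \in residual G.
    by rewrite !mem_elt_gen //; apply: sub_p_elt qy => s /eqnP->; rewrite !inE.
  suffices cPW : residual G \subset 'C(P) by apply: (subsetP cPW).
  have nsWG := residual_normal G.
  apply/commG1P/trivgP; rewrite -(coprime_TIg (pnat_coprime (pHall_pgroup sylP) p'W)).
  rewrite subsetI commg_subr commg_subl; apply/andP; split.
    exact: subset_trans (normal_sub nsWG) (normal_norm nsPG).
  exact: subset_trans (normal_sub nsPG) (normal_norm nsWG).
move=> P G nsPG sylP cPq.
have [eq_qp | ne_qp] := eqVneq q p; last first.
  apply: (@elt_gen_p'group _ _ P) => [x Ex px|].
    by rewrite (mem_normal_Hall sylP) ?(subsetP (elt_gen_sub q G)).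
  by apply/elt_gen_subP; apply: cPq.
have pE : p.-group (elt_gen q G).
  apply: pgroupS (pHall_pgroup sylP); apply/elt_gen_subP=> x Gx.
  by rewrite eq_qp => px; rewrite (mem_normal_Hall sylP).
suffices sW1 : residual G \subset [1] by apply: pgroupS sW1 (pgroup1 _ _).
apply/elt_gen_subP=> x Ex p'x; rewrite inE -order_eq1; apply/eqP/(@pnat_1 p) => //.
exact: mem_p_elt pE Ex.
Qed.

End EdgeFreeClasses.

(** * Translation between edges and classes *)

Section Edges.

Variables (gT : finGroupType) (G : {group gT}) (p q : nat).

Lemma pi_p_elt y : prime q -> y \in G -> q.-elt y -> y != 1 -> q \in \pi(G).
Proof.
move=> pr_q Gy qy nty; rewrite mem_primes pr_q cardG_gt0.
apply: dvdn_trans (order_dvdG Gy).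
by have [] := pgroup_pdiv (G := <[y]>) qy; rewrite ?cycle_eq1.
Qed.

Lemma norm_cent_pi b : prime p -> prime q -> ~~ norm_cent p q b G ->
  p \in \pi(G) /\ q \in \pi(G).
Proof.
move=> pr_p pr_q; rewrite negb_forall => /existsP[P].
rewrite negb_forall => /existsP[y]; rewrite negb_imply.
case/andP=> /and3P[/and3P[sPG pP _] /setIP[Gy _] qy] not_cPy; split.
  apply: contraR not_cPy; rewrite -p'groupEpi => p'G.
  have -> : P :=: 1.
    by apply/eqP; rewrite -(setIid P) (coprime_TIg (pnat_coprime pP (pgroupS sPG p'G))).
  by rewrite cent1T inE.
by apply: pi_p_elt Gy qy _ => //; apply: contraNneq not_cPy => ->; apply: group1.
Qed.

Lemma join_subcent_normal (P : {group gT}) :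
  P \subset G -> P <*> 'C_G(P) <| 'N_G(P).
Proof.
move=> sPG; have nsPN : P <| 'N_G(P) by rewrite normal_subnorm.
have sCN : 'C_G(P) \subset 'N_G(P) by rewrite setIS ?cent_sub.
apply/andP; split; first by rewrite join_subG (normal_sub nsPN).
by rewrite normsY ?normal_norm // subcent_normal.
Qed.

(** The edge gives a [q]-element of ['N_G(P)] outside [P * 'C_G(P)]. It is not a [p]-element, since
    [P] contains all [p]-elements of its normalizer. *)
Lemma sylow_edge_norm_cent : gE (sylow_graph G) p q -> p != q /\ ~~ norm_cent p q true G.
Proof.
case=> [pG qG [P [+ q_idx]]]; rewrite inE => sylP.
have sPG := pHall_sub sylP; have pP := pHall_pgroup sylP.
have defM : P <*> 'C_G(P) = P * 'C_G(P) by rewrite cent_joinEr ?subsetIr.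
have nsPN : P <| 'N_G(P) by rewrite normal_subnorm.
have /andP[sMN nMN] := join_subcent_normal sPG.
have sylPN : p.-Sylow('N_G(P)) P := pHall_subl (normal_sub nsPN) (subsetIl _ _) sylP.
have notM : ~ (forall y, y \in 'N_G(P) -> q.-elt y -> y \in P <*> 'C_G(P)).
  move/(pi'_quotientP _ nMN); rewrite /pgroup card_quotient //= defM => q'idx.
  have /negP[] : q \notin \pi(#|'N_G(P) : P * 'C_G(P)|) by rewrite -p'natEpi.
  exact: q_idx.
split.
  apply/eqP=> eq_pq; apply: notM => y Ny; rewrite -eq_pq => py.
  by rewrite (subsetP (joing_subl _ _)) // (mem_normal_Hall sylPN).
apply/norm_centP=> FG; apply: notM => y Ny qy.
rewrite (subsetP (joing_subr _ _)) // inE (FG P) ?andbT //; first by case/setIP: Ny.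
by rewrite /psub sPG pP sylP.
Qed.

Lemma norm_cent_sylow_edge : prime p -> prime q -> p != q ->
  ~~ norm_cent p q true G -> gE (sylow_graph G) p q.
Proof.
move=> pr_p pr_q ne_pq nFG; have [pG qG] := norm_cent_pi pr_p pr_q nFG.
move: nFG; rewrite negb_forall => /existsP[P].
rewrite negb_forall => /existsP[y]; rewrite negb_imply.
case/andP=> /and3P[/and3P[sPG pP /= sylP] Ny qy] not_cPy; split=> //.
exists P; split; first by rewrite inE.
have defM : P <*> 'C_G(P) = P * 'C_G(P) by rewrite cent_joinEr ?subsetIr.
have /andP[sMN nMN] := join_subcent_normal sPG.
apply: contraR not_cPy => q'idx.
have q'M : q^'.-group ('N_G(P) / (P <*> 'C_G(P))).
  by rewrite /pgroup card_quotient // p'natEpi ?indexg_gt0 //= defM.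
have My := pi'_quotientP _ nMN q'M y Ny qy.
have nCM : P <*> 'C_G(P) \subset 'N('C_G(P)).
  by rewrite (subset_trans sMN) ?normal_norm ?subcent_normal.
(* This quotient is an image of [P], so the [q]-elements of [P <*> 'C_G(P)] centralize [P]. *)
have q'C : q^'.-group (P <*> 'C_G(P) / 'C_G(P)).
  rewrite defM quotientMidr; apply: sub_pgroup (quotient_pgroup _ pP) => s /eqnP->.
  by rewrite !inE.
by have /setIP[] := pi'_quotientP _ nCM q'C y My qy.
Qed.

(** A complement [X] of the normal Sylow [p]-subgroup of the Schmidt group is a [q]-group; were it
    to centralize that subgroup, the Schmidt group would be nilpotent. *)
Lemma ncritical_edge_norm_cent : prime p -> prime q ->
  gE (ncritical_graph G) p q -> p != q /\ ~~ norm_cent p q false G.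
Proof.
move=> pr_p pr_q [pG qG [S [sSG [[nnilS _] piS [P [+ nsPS]]]]]]; rewrite inE => sylP.
have pP := pHall_pgroup sylP; have sPS := normal_sub nsPS.
have /splitsP[X /complP[tiPX defS]] := SchurZassenhaus_split (pHall_Hall sylP) nsPS.
have sXS : X \subset S by rewrite -defS mulG_subr.
have p'X : p^'.-group X.
  have /and3P[_ _] := sylP; by rewrite -divgS // -defS TI_cardMg // mulKn.
have qX : q.-group X.
  apply/pgroupP=> s pr_s s_dv_X; have sX : s \in \pi(X) by rewrite mem_primes pr_s cardG_gt0.
  have /piS[eq_sp | -> //] := piSg sXS sX; last by rewrite !inE.
  by have := pnatPpi p'X sX; rewrite eq_sp !inE eqxx.
split.
  apply: contra nnilS => /eqP eq_pq; apply: (pgroup_nil (p := p)).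
  by rewrite -defS pgroupM pP eq_pq.
apply: contra nnilS => /norm_centP FG.
have cPX : X \subset 'C(P).
  apply/subsetP=> x Xx; have Sx := subsetP sXS x Xx.
  apply: FG; last exact: mem_p_elt qX Xx.
    by rewrite /psub (subset_trans sPS) // pP.
  by rewrite inE (subsetP sSG) // (subsetP (normal_norm nsPS)).
by rewrite (cprod_nil (etrans (cprodE cPX) defS)) (pgroup_nil pP) (pgroup_nil qX).
Qed.

(** If [y] does not centralize [P], then [P <*> <[y]>] is not nilpotent, and a minimal non-nilpotent
    subgroup of it is the Schmidt group sought. Both primes divide its order, as groups of prime
    power order are nilpotent. *)
Lemma norm_cent_ncritical_edge : prime p -> prime q -> p != q ->
  ~~ norm_cent p q false G -> gE (ncritical_graph G) p q.
Proof.
move=> pr_p pr_q ne_pq nFG; have [pG qG] := norm_cent_pi pr_p pr_q nFG.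
move: nFG; rewrite negb_forall => /existsP[P].
rewrite negb_forall => /existsP[y]; rewrite negb_imply.
case/andP=> /and3P[/and3P[sPG pP _] /setIP[Gy nPy] qy] not_cPy; split=> //.
pose H := P <*> <[y]>.
have nPY : <[y]> \subset 'N(P) by rewrite cycle_subG.
have defH : H = P * <[y]> by rewrite /H norm_joinEr.
have coPY : coprime #|P| #|<[y]>|.
  by apply: (pnat_coprime pP); apply: sub_p_elt qy => s /eqnP->; rewrite !inE /= eq_sym.
have nnilH : ~~ nilpotent H.
  apply: contra not_cPy => nilH; rewrite -cycle_subG.
  by rewrite (sub_nilpotent_cent2 nilH) ?joing_subl ?joing_subr // coprime_sym.
have [S minS sSH] := mingroup_exists (gP := fun S => ~~ nilpotent S) nnilH.
have [nnilS Smin] := mingroupP minS.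
have nsPH : P <| H by rewrite /normal joing_subl join_subG normG.
have sylP : p.-Sylow(H) P.
  rewrite /pHall joing_subl pP -divgS ?joing_subl //= -/H defH coprime_cardMg // mulKn //.
  by apply: sub_p_elt qy => s /eqnP->; rewrite !inE /= eq_sym.
have piH : [pred r | (r == p) || (r == q)].-group H.
  rewrite defH pgroupM; apply/andP; split.
    by apply: sub_pgroup pP => s /eqnP->; rewrite inE eqxx.
  by apply: sub_pgroup (qy : q.-group <[y]>) => s /eqnP->; rewrite inE eqxx orbT.
have piS := pgroupS sSH piH.
have pi_mem r s : r \in [:: p; q] -> s \in [:: p; q] -> r != s -> prime r -> r \in \pi(S).
  move=> pq_r pq_s ne_rs pr_r; apply: contraR nnilS; rewrite -p'groupEpi => r'S.
  apply: (pgroup_nil (p := s)); apply/pgroupP=> t pr_t t_dv_S.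
  have := pgroupP piS t pr_t t_dv_S; have := pgroupP r'S t pr_t t_dv_S.
  rewrite !inE => ne_tr; move: pq_r pq_s ne_rs ne_tr; rewrite !inE.
  by case/orP=> /eqP-> /orP[]/eqP->; rewrite ?eqxx // => _ /negPf->; rewrite ?orbF.
exists S; split.
  by rewrite (subset_trans sSH) // join_subG sPG cycle_subG.
split.
- split=> // K /andP[sKS nsSK]; apply: contraR nsSK => nnilK.
  by rewrite (Smin K nnilK sKS).
- move=> r; split=> [/(pnatPpi piS) | ].
    by rewrite inE => /orP[]/eqP; [left | right].
  by case=> ->; [apply: (pi_mem p q) | apply: (pi_mem q p)]; rewrite ?inE ?eqxx ?orbT // eq_sym.
exists [group of P :&: S]; split; first by rewrite inE (setI_normal_Hall nsPH).
by rewrite /normal subsetIr normsI ?normG // (subset_trans sSH) ?normal_norm.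
Qed.

Lemma p'core_sub_p'p : 'O_p^'(G) \subset 'O_{p^', p}(G).
Proof. by rewrite -pseries1; apply: (pseries_sub_catl [:: p^' : nat_pred] [:: p : nat_pred]). Qed.

(** A residual that is a [p']-group lies in ['O_p^'(G)]. Then [elt_gen q G] lies in
    ['O_{p^', p}(G)], whose quotient is therefore a [q']-group. *)
Lemma hawkes_edge_residual : gE (hawkes_graph G) p q -> ~~ p^'.-group (residual p q G).
Proof.
case=> pG qG qGO; apply/negP=> p'W.
have sEG := elt_gen_sub q G.
have nNG : G \subset 'N('O_p^'(G)) by rewrite normal_norm ?pcore_normal.
have sWN : residual p q G \subset 'O_p^'(G) by rewrite pcore_max ?residual_normal.
have pEN : p.-group (elt_gen q G / 'O_p^'(G)).
  rewrite -pgroupNK; apply/pi'_quotientP; first exact: subset_trans nNG.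
  by move=> x Ex p'x; apply: (subsetP sWN); apply: mem_elt_gen.
have sEO : elt_gen q G \subset 'O_{p^', p}(G).
  rewrite -(quotientSGK (subset_trans sEG nNG) p'core_sub_p'p) /= quotient_pseries2.
  by rewrite pcore_max ?quotient_normal ?elt_gen_normal.
have q'GO : q^'.-group (G / 'O_{p^', p}(G)).
  apply/pi'_quotientP; first by rewrite normal_norm ?pseries_normal.
  by apply/elt_gen_subP.
by move: q'GO; rewrite p'groupEpi qGO.
Qed.

(** If [q] does not divide the index of ['O_{p^', p}(G)], this subgroup contains [elt_gen q G], and
    its [p']-elements lie in ['O_p^'(G)]. *)
Lemma residual_hawkes_edge : prime p -> prime q ->
  ~~ p^'.-group (residual p q G) -> gE (hawkes_graph G) p q.
Proof.
move=> pr_p pr_q not_p'W.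
have sWG := normal_sub (residual_normal p q G).
have nNG : G \subset 'N('O_p^'(G)) by rewrite normal_norm ?pcore_normal.
split.
- by apply: contraR not_p'W; rewrite -p'groupEpi => /(pgroupS sWG).
- apply: contraR not_p'W; rewrite -p'groupEpi => q'G.
  apply: pgroupS (pgroup1 _ p^'); apply: subset_trans (elt_gen_sub _ _) _.
  apply/elt_gen_subP=> x Gx qx; rewrite inE -order_eq1; apply/eqP/(@pnat_1 q) => //.
  exact: mem_p_elt q'G Gx.
apply: contraR not_p'W; rewrite -p'groupEpi => q'GO.
have nOG : G \subset 'N('O_{p^', p}(G)) by rewrite normal_norm ?pseries_normal.
apply: pgroupS (pcore_pgroup p^' G); apply/elt_gen_subP=> x Ex p'x.
have Ox : x \in 'O_{p^', p}(G).
  by apply: subsetP Ex; apply/elt_gen_subP; apply/pi'_quotientP.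
have nNO : 'O_{p^', p}(G) \subset 'N('O_p^'(G)).
  exact: subset_trans (normal_sub (pseries_normal _ _)) nNG.
have p''ON : p^'^'.-group ('O_{p^', p}(G) / 'O_p^'(G)).
  by rewrite pgroupNK quotient_pseries2 pcore_pgroup.
exact: (pi'_quotientP _ nNO p''ON).
Qed.

End Edges.

Theorem theorem2 (gT : finGroupType) (G : {group gT}) (n : nat)
    (Gs : 'I_n -> {group gT})
    (sub_G : forall i, Gs i \subset G)
    (prodG : (G : {set gT}) = \prod_(i < n) (Gs i : {set gT}))
    (tperm : forall i j, i != j -> totally_permutable (Gs i) (Gs j)) :
  [/\ gsub (sylow_graph G)
        (gunion (gbigunion (fun i => sylow_graph (Gs i))) (gamma_graph G)),
      gsub (hawkes_graph G)
        (gunion (gbigunion (fun i => hawkes_graph (Gs i))) (gamma_graph G)) &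
      gsub (ncritical_graph G)
        (gunion (gbigunion (fun i => ncritical_graph (Gs i))) (gamma_graph G))].
Proof.
have tpG : tp_factorization G Gs by split.
(* The three inclusions follow alike, with a class [F] chosen for each edge. *)
have edges (Gamma : {group gT} -> graph) :
    (forall p, gV (Gamma G) p -> p \in \pi(G)) ->
    (forall p q, gE (Gamma G) p q ->
      [/\ p \in \pi(G), q \in \pi(G) & prime p -> prime q ->
        exists F : forall hT : finGroupType, {group hT} -> bool,
          [/\ edge_free_class p q F, ~~ F _ G &
              forall A : {group gT}, ~~ F _ A -> gE (Gamma A) p q]]) ->
  gsub (Gamma G) (gunion (gbigunion (fun i => Gamma (Gs i))) (gamma_graph G)).
  move=> GammaV GammaE; split=> [p /GammaV | p q /GammaE[pG qG ]]; first by right.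
  have pr_p : prime p by move: pG; rewrite mem_primes => /and3P[].
  have pr_q : prime q by move: qG; rewrite mem_primes => /and3P[].
  case=> // F [classF nFG FE]; have [q_p1 | q'p1] := boolP (q %| p.-1).
    (* Here [p > 1] matters: [\pi(0)] is empty, so [p.-1] has to be positive. *)
    by right; split=> //; rewrite mem_primes pr_q q_p1 -subn1 subn_gt0 prime_gt1.
  have [allF | ] := boolP [forall i, F _ (Gs i)].
    case/negP: nFG; apply: tp_factorization_class classF pr_p pr_q q'p1 tpG _ => i.
    exact: (forallP allF).
  by rewrite negb_forall => /existsP[i /FE]; left; exists i.
split; apply: edges => // p q pq; have [pG qG _] := pq; split=> // pr_p pr_q.
- have [ne_pq nFG] := sylow_edge_norm_cent pq.
  exists (@norm_cent p q true); split=> // [|A]; first exact: norm_cent_class.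
  exact: norm_cent_sylow_edge.
- exists (fun hT A => p^'.-group (@residual p q hT A)); split=> [||A].
  + exact: residual_class.
  + exact: hawkes_edge_residual.
  exact: residual_hawkes_edge.
have [ne_pq nFG] := ncritical_edge_norm_cent pr_p pr_q pq.
exists (@norm_cent p q false); split=> // [|A]; first exact: norm_cent_class.
exact: norm_cent_ncritical_edge.
Qed.
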